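(* Let $F:\mathcal{B}^{op}\to Cat$ be a functor (or just a pseudofunctor), let $\pi:\mathcal{X}\to\mathcal{B}$ be the fibration obtained from $F$ by the Grothendieck construction, and let $F'$ be $F$ followed by the (covariant) dualization functor $Cat\to Cat$, $\mathcal{C}\mapsto\mathcal{C}^{op}$. Then the fibration over $\mathcal{B}$ obtained from $F'$ by the Grothendieck construction is isomorphic, as a category over $\mathcal{B}$, to the fibrewise dual $\pi^{*}:\mathcal{X}^{*}\to\mathcal{B}$ of $\pi:\mathcal{X}\to\mathcal{B}$, whose arrows are equivalence classes of vh spans in $\mathcal{X}$.
   Context: Composition of arrows is written from left to right: $f.g$ means first $f$, then $g$. Cartesian and vertical arrows; fibrations. Let $\pi:\mathcal{X}\to\mathcal{B}$ be a functor. For $\alpha:A\to B$ in $\mathcal{B}$ and objects $X,Y$ of $\mathcal{X}$ with $\pi(X)=A$, $\pi(Y)=B$, let $\hom_{\alpha}(X,Y)$ be the set of arrows $h:X\to Y$ with $\pi(h)=\alpha$. An arrow $h\in\hom_\alpha(X,Y)$ is cartesian (with respect to $\pi$) if for every arrow $\xi:C\to A$ in $\mathcal{B}$ and every object $Z$ with $\pi(Z)=C$, the map $\hom_{\xi}(Z,X)\to\hom_{\xi.\alpha}(Z,Y)$, $k\mapsto k.h$, is a bijection. The functor $\pi$ is a fibration if for every $\alpha:A\to B$ in $\mathcal{B}$ and every $Y$ with $\pi(Y)=B$ there is a cartesian arrow over $\alpha$ with codomain $Y$. An arrow of $\mathcal{X}$ is vertical if $\pi$ maps it to an identity arrow. The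 category $\mathcal{X}^{*}$. Let $\pi:\mathcal{X}\to\mathcal{B}$ be a fibration. A vh span in $\mathcal{X}$ from $X$ to $Y$ is a pair $(v,h)$ of arrows of $\mathcal{X}$ with common domain, where $v$ is vertical with codomain $X$ and $h$ is cartesian with codomain $Y$. Two vh spans $(v,h)$, $(v',h')$ from $X$ to $Y$ are equivalent, $(v,h)\equiv(v',h')$, if there is a vertical isomorphism $i$ in $\mathcal{X}$ with $i.v=v'$ and $i.h=h'$; the equivalence class of $(v,h)$ is denoted $\{(v,h)\}$. The category $\mathcal{X}^{*}$ has the same objects as $\mathcal{X}$, and its arrows $X\to Y$ are the equivalence classes of vh spans from $X$ to $Y$. For $\{(v_1,h_1)\}:X\to Y$ and $\{(v_2,h_2)\}:Y\to Z$, the composite is $\{(v_1,h_1)\}.\{(v_2,h_2)\}:=\{(w.v_1,\,k.h_2)\}$, where $k$ is a cartesian arrow over $\pi(h_1)$ whose codomain is the domain of $v_2$, and $w$ is the unique vertical arrow with $w.h_1=k.v_2$ (this is independent of the choices). The identity on $X$ is $\{(1_X,1_X)\}$. The functor $\pi^{*}:\mathcal{X}^{*}\to\mathcal{B}$ agrees with $\pi$ on objects, and $\pi^{*}(\{(v,h)\})=\pi(h)$. Grothendieck construction. For a pseudofunctor $F:\mathcal{B}^{op}\to Cat$ and $\alpha:A\to B$ in $\mathcal{B}$, write $\alpha^{*}:=F(\alpha):F(B)\to F(A)$. The associated fibration has as total category the category whose objects are pairs $(X,A)$ with $A$ an object of $\mathcal{B}$ and $X$ an object of $F(A)$, and whose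 arrows $(X,A)\to(Y,B)$ are pairs $(v,\alpha)$ with $\alpha:A\to B$ in $\mathcal{B}$ and $v:X\to\alpha^{*}(Y)$ in $F(A)$. The composite of $(v,\alpha):(X,A)\to(Y,B)$ and $(w,\beta):(Y,B)\to(Z,C)$ is $(v.\alpha^{*}(w).\varphi,\ \alpha.\beta)$, where $\varphi:\alpha^{*}(\beta^{*}(Z))\to(\alpha.\beta)^{*}(Z)$ is the coherence isomorphism of $F$; identities are given by the coherence isomorphisms $X\to(1_A)^{*}(X)$. (For a strict functor all coherence isomorphisms are identities.) The functor to $\mathcal{B}$ sends $(X,A)$ to $A$ and $(v,\alpha)$ to $\alpha$. The pseudofunctor $F'$ has $F'(A)=F(A)^{op}$ and $F'(\alpha)=F(\alpha)^{op}$, with coherence isomorphisms given by the inverses of those of $F$, regarded as arrows in the opposite categories. *)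

(* Defs.v *)
From Corelib Require Import ssreflect ssrfun ssrbool.
From Stdlib Require Import Description Eqdep ProofIrrelevance.
From Stdlib Require Import FunctionalExtensionality PropExtensionality.

Set Implicit Arguments.
Unset Strict Implicit.
Unset Printing Implicit Defensive.
Set Bullet Behavior "None".

Declare Scope cat_scope.
Delimit Scope cat_scope with cat.
Local Open Scope cat_scope.

(** Composition is written from left to right: [f ;; g] is first [f], then
    [g].  Hom-types carry Leibniz equality. *)

Record category := Category {
  ob :> Type;
  hom : ob -> ob -> Type;
  idm : forall a, hom a a;
  comp : forall a b c, hom a b -> hom b c -> hom a c;
  comp1m : forall a b (f : hom a b), comp (idm a) f = f;
  compm1 : forall a b (f : hom a b), comp f (idm b) = f;
  compA : forall a b c d (f : hom a b) (g : hom b c) (h : hom c d),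
    comp (comp f g) h = comp f (comp g h) }.

Arguments hom {C} _ _ : rename.
Arguments idm {C} a : rename.
Arguments comp {C a b c} _ _ : rename.

Notation "f ;; g" := (comp f g)
  (at level 50, left associativity, format "f  ;;  g") : cat_scope.

Lemma inv_comp (C : category) (a b c : C) (f : hom a b) (f' : hom b a)
    (g : hom b c) (g' : hom c b) :
  f' ;; f = idm b -> g' ;; g = idm c -> (g' ;; f') ;; (f ;; g) = idm c.
Proof. by move=> ef eg; rewrite compA -(compA f') ef comp1m. Qed.

Lemma compK (C : category) (a b c : C) (f : hom b c) (f' : hom c b)
    (u : hom a c) : f' ;; f = idm c -> (u ;; f') ;; f = u.
Proof. by move=> e; rewrite compA e compm1. Qed.

Definition is_iso (C : category) (a b : C) (f : hom a b) : Prop :=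
  exists g : hom b a, f ;; g = idm a /\ g ;; f = idm b.

Record functor (C D : category) := Functor {
  fob :> C -> D;
  fmap : forall a b, hom a b -> hom (fob a) (fob b);
  fmap1 : forall a, fmap (idm a) = idm (fob a);
  fmapM : forall a b c (f : hom a b) (g : hom b c),
    fmap (f ;; g) = fmap f ;; fmap g }.

Arguments fmap {C D} _ {a b} _.

Lemma fmap_inv (C D : category) (F : functor C D) (a b : C) (f : hom a b)
    (f' : hom b a) : f' ;; f = idm b -> fmap F f' ;; fmap F f = idm (F b).
Proof. by move=> e; rewrite -fmapM e fmap1. Qed.

Program Definition functor_id (C : category) : functor C C :=
  {| fob := fun a => a; fmap := fun a b f => f |}.

Program Definition functor_comp (C D E : category)
    (F : functor C D) (G : functor D E) : functor C E :=
  {| fob := fun a => G (F a); fmap := fun a b f => fmap G (fmap F f) |}.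
Next Obligation. by rewrite !fmap1. Qed.
Next Obligation. by rewrite !fmapM. Qed.

Record nat_iso (C D : category) (F G : functor C D) := NatIso {
  ni_map :> forall a, hom (F a) (G a);
  ni_inv : forall a, hom (G a) (F a);
  ni_mapK : forall a, ni_map a ;; ni_inv a = idm (F a);
  ni_invK : forall a, ni_inv a ;; ni_map a = idm (G a);
  ni_natural : forall a b (f : hom a b),
    fmap F f ;; ni_map b = ni_map a ;; fmap G f }.

Program Definition op (C : category) : category :=
  {| ob := ob C; hom := fun a b => @hom C b a; idm := fun a => @idm C a;
     comp := fun a b c f g => @comp C c b a g f |}.
Next Obligation. exact: compm1. Qed.
Next Obligation. exact: comp1m. Qed.
Next Obligation. by rewrite compA. Qed.

Program Definition functor_op (C D : category) (F : functor C D) :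
    functor (op C) (op D) :=
  {| fob := fob F : op C -> op D; fmap := fun a b f => fmap F f |}.
Next Obligation. exact: fmap1. Qed.
Next Obligation. exact: fmapM. Qed.

(** An arrow bundled with its endpoints: used to compare arrows whose domains
    and codomains are only propositionally equal. *)

Record arrow (C : category) := Arrow {
  arrow_dom : C;
  arrow_cod : C;
  arrow_hom : hom arrow_dom arrow_cod }.

Arguments Arrow {C arrow_dom arrow_cod} _.

(** [f ≈ g]: same domain, same codomain, and equal as arrows. *)
Notation "f ≈ g" := (Arrow f = Arrow g) (at level 70) : cat_scope.

Section ArrowEquality.
Variable C : category.

Lemma arr_eq (a b : C) (f g : hom a b) : f ≈ g -> f = g.
Proof.
move=> e; pose P (u : arrow C) := existT (fun p => hom (fst p) (snd p))
  (arrow_dom u, arrow_cod u) (arrow_hom u).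
have eP : P (Arrow f) = P (Arrow g) by rewrite e.
exact: inj_pair2 eP.
Qed.

Lemma arr_dom (a b c d : C) (f : hom a b) (g : hom c d) : f ≈ g -> a = c.
Proof. exact: (f_equal (@arrow_dom C)). Qed.

Lemma arr_cod (a b c d : C) (f : hom a b) (g : hom c d) : f ≈ g -> b = d.
Proof. exact: (f_equal (@arrow_cod C)). Qed.

Lemma arr_comp (a b c a' b' c' : C) (f : hom a b) (g : hom b c)
    (f' : hom a' b') (g' : hom b' c') :
  f ≈ f' -> g ≈ g' -> f ;; g ≈ f' ;; g'.
Proof.
move=> ef eg; move: (arr_dom ef) (arr_cod ef) (arr_cod eg) => e1 e2 e3.
by subst a' b' c'; rewrite (arr_eq ef) (arr_eq eg).
Qed.

Lemma arr_cast (a b a' b' : C) (f : hom a b) :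
  a = a' -> b = b' -> exists f' : hom a' b', f' ≈ f.
Proof. by move=> <- <-; exists f. Qed.

Lemma arr_idl (a b c d : C) (f : hom a b) (g : hom b d) :
  f ≈ idm c -> f ;; g ≈ g.
Proof.
move=> e; move: (arr_dom e) (arr_cod e) => e1 e2; subst a b.
by rewrite (arr_eq e) comp1m.
Qed.

Lemma arr_idr (a b c d : C) (f : hom a b) (g : hom d a) :
  f ≈ idm c -> g ;; f ≈ g.
Proof.
move=> e; move: (arr_dom e) (arr_cod e) => e1 e2; subst a b.
by rewrite (arr_eq e) compm1.
Qed.

Lemma arr_idm (a b : C) : a = b -> idm a ≈ idm b.
Proof. by move=> ->. Qed.

Lemma arr_inv (a b b' : C) (f : hom a b) (f' : hom a b')
    (g : hom b a) (g' : hom b' a) :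
  f ≈ f' -> g ;; f = idm b -> f' ;; g' = idm a -> g ≈ g'.
Proof.
move=> e gf fg'; move: (arr_cod e) => e'; subst b'.
move: (arr_eq e) => e1; subst f'.
by rewrite -(compm1 g) -fg' -compA gf comp1m.
Qed.

Lemma arr_op (a b c d : C) (f : hom a b) (g : hom c d) :
  f ≈ g -> @Arrow (op C) b a f = @Arrow (op C) d c g.
Proof.
move=> e; exact (f_equal (fun u : arrow C =>
  @Arrow (op C) (arrow_cod u) (arrow_dom u) (arrow_hom u)) e).
Qed.

End ArrowEquality.

Lemma arr_fmap (C D : category) (F : functor C D) (a b c d : C)
    (f : hom a b) (g : hom c d) : f ≈ g -> fmap F f ≈ fmap F g.
Proof.
by move=> e; exact (f_equal (fun u : arrow C => Arrow (fmap F (arrow_hom u))) e).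
Qed.

Section Fibration.
Variables (X B : category) (p : functor X B).

Definition vertical (x y : X) (f : hom x y) : Prop :=
  exists a : B, fmap p f ≈ idm a.

(** Unique existence of [k] says that [k |-> k ;; h] is a bijection from
    [hom_xi(z, x)] to [hom_{xi ;; p h}(z, y)]. *)
Definition cartesian (x y : X) (h : hom x y) : Prop :=
  forall (z : X) (xi : hom (p z) (p x)) (l : hom z y),
    fmap p l = xi ;; fmap p h ->
    exists! k : hom z x, fmap p k = xi /\ k ;; h = l.

Definition is_fibration : Prop :=
  forall (a b : B) (alpha : hom a b) (y : X), p y = b ->
    exists (x : X) (h : hom x y), cartesian h /\ fmap p h ≈ alpha.

Lemma verticalE (x y : X) (f : hom x y) :
  vertical f -> fmap p f ≈ idm (p x) /\ p x = p y.
Proof.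
move=> [a e]; split; last by rewrite (arr_dom e) (arr_cod e).
by rewrite e; apply: arr_idm; rewrite (arr_dom e).
Qed.

Lemma vertical_id (x : X) : vertical (idm x).
Proof. by exists (p x); rewrite fmap1. Qed.

Lemma vertical_comp (x y z : X) (f : hom x y) (g : hom y z) :
  vertical f -> vertical g -> vertical (f ;; g).
Proof.
move=> [a ef] [b eg]; exists b; rewrite fmapM.
by rewrite (arr_idl _ ef).
Qed.

Lemma over_idl (x y z : X) (f : hom x y) (g : hom y z) :
  vertical f -> fmap p (f ;; g) ≈ fmap p g.
Proof. by move=> [a e]; rewrite fmapM; apply: arr_idl e. Qed.

Lemma over_idr (x y z : X) (f : hom x y) (g : hom y z) :
  vertical g -> fmap p (f ;; g) ≈ fmap p f.
Proof. by move=> [a e]; rewrite fmapM; apply: arr_idr e. Qed.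

Lemma cartesian_inj (x y z : X) (h : hom x y) (k k' : hom z x) :
  cartesian h -> fmap p k ≈ fmap p k' -> k ;; h = k' ;; h -> k = k'.
Proof.
move=> ch /arr_eq e eh.
have [|u [_ uu]] := ch z (fmap p k) (k ;; h); first by rewrite fmapM.
by rewrite -(uu k) // -(uu k') //; split.
Qed.

Lemma cartesian_lift (x y z : X) (h : hom x y) (l : hom z y)
    (a b c : B) (xi : hom a b) (eta : hom b c) :
  cartesian h -> a = p z -> fmap p h ≈ eta -> fmap p l ≈ xi ;; eta ->
  exists k : hom z x, fmap p k ≈ xi /\ k ;; h = l.
Proof.
move=> ch ea eh el.
have [xi' exi] := arr_cast xi ea (esym (arr_dom eh)).
have [|k [[k1 k2] _]] := ch z xi' l.
  by apply: arr_eq; rewrite el; apply: esym; apply: arr_comp.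
by exists k; rewrite k1.
Qed.

Lemma cartesian_lift_vertical (x y z : X) (h : hom x y) (l : hom z y) :
  cartesian h -> fmap p l ≈ fmap p h ->
  exists w : hom z x, vertical w /\ w ;; h = l.
Proof.
move=> ch e.
have [|||w [w1 w2]] := @cartesian_lift x y z h l _ _ _ (idm (p x)) (fmap p h) ch.
- exact: esym (arr_dom e).
- by [].
- by rewrite comp1m.
by exists w; split=> //; exists (p x).
Qed.

Lemma vertical_eq (x y : X) (f g : hom x y) :
  vertical f -> vertical g -> fmap p f ≈ fmap p g.
Proof. by move=> /verticalE [-> _] /verticalE [-> _]. Qed.

Lemma cartesian_comp (x y z : X) (f : hom x y) (g : hom y z) :
  cartesian f -> cartesian g -> cartesian (f ;; g).
Proof.
move=> cf cg w xi l el.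
have [|m [[m1 m2] _]] := cg w (xi ;; fmap p f) l.
  by rewrite el fmapM compA.
have [k [[k1 k2] _]] := cf w xi m m1.
exists k; split; first by split; [|rewrite -compA k2].
move=> k' [k1' k2']; apply: (cartesian_inj cf); first by rewrite k1 k1'.
apply: (cartesian_inj cg); first by rewrite !fmapM k1 k1'.
by rewrite k2 m2 compA.
Qed.

Lemma cartesian_cancel (x y z : X) (f : hom x y) (g : hom y z) :
  cartesian g -> cartesian (f ;; g) -> cartesian f.
Proof.
move=> cg cfg w xi l el.
have [|k [[k1 k2] _]] := cfg w xi (l ;; g).
  by rewrite !fmapM el compA.
have kl : k ;; f = l.
  by apply: (cartesian_inj cg); rewrite ?compA // fmapM k1 el.
exists k; split=> // k' [k1' k2'].
by apply: (cartesian_inj cfg); rewrite ?k1 ?k1' // k2 -k2' compA.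
Qed.

Lemma cartesian_iso (x y : X) (f : hom x y) : is_iso f -> cartesian f.
Proof.
move=> [g [fg gf]] z xi l el; exists (l ;; g); split.
  split; last by rewrite compA gf compm1.
  by rewrite fmapM el compA -fmapM fg fmap1 compm1.
by move=> k [_ <-]; rewrite compA fg compm1.
Qed.

Lemma cartesian_vertical_iso (x x' y : X) (k : hom x y) (k' : hom x' y) :
  cartesian k -> cartesian k' -> fmap p k' ≈ fmap p k ->
  exists i : hom x' x, [/\ vertical i, is_iso i & i ;; k = k'].
Proof.
move=> ck ck' e.
have [i [vi ik]] := cartesian_lift_vertical ck e.
have [j [vj jk]] := cartesian_lift_vertical ck' (esym e).
exists i; split=> //; exists j; split.
  apply: (cartesian_inj ck'); last by rewrite comp1m compA jk.
  by apply: vertical_eq; [apply: vertical_comp|apply: vertical_id].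
apply: (cartesian_inj ck); last by rewrite comp1m compA ik.
by apply: vertical_eq; [apply: vertical_comp|apply: vertical_id].
Qed.

Record vh_span (x y : X) := VHSpan {
  apex : X;
  vleg : hom apex x;
  hleg : hom apex y;
  vleg_vertical : vertical vleg;
  hleg_cartesian : cartesian hleg }.

Arguments hleg_cartesian {x y} _ _ _ _ _.

Definition vh_equiv (x y : X) (s t : vh_span x y) : Prop :=
  exists i : hom (apex t) (apex s),
    [/\ vertical i, is_iso i, i ;; vleg s = vleg t & i ;; hleg s = hleg t].

Lemma vh_equiv_refl (x y : X) (s : vh_span x y) : vh_equiv s s.
Proof.
exists (idm _); rewrite !comp1m; split=> //; first exact: vertical_id.
by exists (idm _); rewrite comp1m.
Qed.

Lemma vh_equiv_sym (x y : X) (s t : vh_span x y) : vh_equiv s t -> vh_equiv t s.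
Proof.
move=> [i [vi [j [ij ji]] iv ih]]; exists j; split.
- have [ei e] := verticalE vi; exists (p (apex s)).
  have := arr_idr (c := p (apex t)) (fmap p j) ei.
  by rewrite -fmapM ji fmap1.
- by exists i.
- by rewrite -iv -compA ji comp1m.
- by rewrite -ih -compA ji comp1m.
Qed.

Lemma vh_equiv_trans (x y : X) (s t u : vh_span x y) :
  vh_equiv s t -> vh_equiv t u -> vh_equiv s u.
Proof.
move=> [i [vi [i' [i1 i2]] iv ih]] [j [vj [j' [j1 j2]] jv jh]].
exists (j ;; i); split; first exact: vertical_comp.
- exists (i' ;; j'); split.
    by rewrite compA -(compA i) i1 comp1m j1.
  by rewrite compA -(compA j') j2 comp1m i2.
- by rewrite compA iv.
- by rewrite compA ih.
Qed.

(** Equivalence classes are represented as sets of vh spans; with functional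
    and propositional extensionality two of them are equal exactly when their
    representatives are equivalent (see [vh_class_eq]). *)
Definition vh_arrow (x y : X) : Type :=
  {c : vh_span x y -> Prop | exists s, c = vh_equiv s}.

Definition vh_in (x y : X) (c : vh_arrow x y) (s : vh_span x y) : Prop :=
  proj1_sig c s.

Definition vh_class (x y : X) (s : vh_span x y) : vh_arrow x y :=
  exist _ (vh_equiv s) (ex_intro _ s eq_refl).

Lemma vh_in_class (x y : X) (s t : vh_span x y) :
  vh_in (vh_class s) t <-> vh_equiv s t.
Proof. by []. Qed.

Lemma vh_arrow_ind (x y : X) (P : vh_arrow x y -> Prop) :
  (forall s, P (vh_class s)) -> forall c, P c.
Proof.
move=> H [c [s e]]; subst c.
by have := H s; rewrite /vh_class.
Qed.

Lemma vh_arrow_ext (x y : X) (c d : vh_arrow x y) :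
  (forall s, vh_in c s <-> vh_in d s) -> c = d.
Proof.
case: c d => [c hc] [d hd] /= H.
have e : c = d.
  by apply: functional_extensionality => s; apply: propositional_extensionality.
by subst d; rewrite (proof_irrelevance _ hc hd).
Qed.

Lemma vh_class_eq (x y : X) (s t : vh_span x y) :
  vh_class s = vh_class t <-> vh_equiv s t.
Proof.
split=> [e|e].
  by rewrite -vh_in_class e vh_in_class; apply: vh_equiv_refl.
apply: vh_arrow_ext => u; rewrite !vh_in_class; split=> H.
  exact: vh_equiv_trans (vh_equiv_sym e) H.
exact: vh_equiv_trans e H.
Qed.

Definition vh_id_span (x : X) : vh_span x x.
Proof.
refine (@VHSpan x x x (idm x) (idm x) (vertical_id x) _).
by apply: cartesian_iso; exists (idm x); rewrite comp1m.
Defined.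

(** [t] is the composite of [s1] and [s2] for some choice of [k] and [w]. *)
Definition vh_composite (x y z : X) (s1 : vh_span x y) (s2 : vh_span y z)
    (t : vh_span x z) : Prop :=
  exists (k : hom (apex t) (apex s2)) (w : hom (apex t) (apex s1)),
    [/\ cartesian k /\ fmap p k ≈ fmap p (hleg s1),
        vertical w /\ w ;; hleg s1 = k ;; vleg s2,
        vleg t = w ;; vleg s1 & hleg t = k ;; hleg s2].

Lemma vh_composite_equiv (x y z : X) (s1 s1' : vh_span x y)
    (s2 s2' : vh_span y z) (t t' : vh_span x z) :
  vh_equiv s1 s1' -> vh_equiv s2 s2' ->
  vh_composite s1 s2 t -> vh_composite s1' s2' t' -> vh_equiv t t'.
Proof.
move=> [i1 [vi1 ii1 iv1 ih1]] [i2 [vi2 ii2 iv2 ih2]].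
move=> [k [w [[ck ek] [vw ew] tv th]]] [k' [w' [[ck' ek'] [vw' ew'] tv' th']]].
have ci2 := cartesian_iso ii2.
have [|i [vi ii ei]] := cartesian_vertical_iso ck (cartesian_comp ck' ci2).
  by rewrite (over_idr _ vi2) ek' ek -ih1 (over_idl _ vi1).
exists i; split=> //.
- rewrite tv tv' -iv1 -!compA; congr (_ ;; _).
  apply: (cartesian_inj (hleg_cartesian s1)).
    by apply: vertical_eq; apply: vertical_comp.
  by rewrite !compA ih1 ew ew' -compA ei -iv2 compA.
- by rewrite th th' -compA ei -ih2 compA.
Qed.

Hypothesis fib : is_fibration.

Lemma vh_composite_ex (x y z : X) (s1 : vh_span x y) (s2 : vh_span y z) :
  exists t, vh_composite s1 s2 t.
Proof.
case: s1 s2 => [z1 v1 h1 vv1 ch1] [z2 v2 h2 vv2 ch2].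
have [_ e] := verticalE vv2.
have [u [k [ck ek]]] := fib (fmap p h1) e.
have [|w [vw ew]] := @cartesian_lift_vertical _ _ _ h1 (k ;; v2) ch1.
  by rewrite (over_idr _ vv2).
exists (@VHSpan x z u (w ;; v1) (k ;; h2) (vertical_comp vw vv1)
  (cartesian_comp ck ch2)).
by exists k, w.
Qed.

Definition vh_comp (x y z : X) (c : vh_arrow x y) (d : vh_arrow y z) :
  vh_arrow x z.
Proof.
exists (fun t => exists s1 s2 s,
  [/\ vh_in c s1, vh_in d s2, vh_composite s1 s2 s & vh_equiv s t]).
move: c d; apply: vh_arrow_ind => s1; apply: vh_arrow_ind => s2.
have [s cs] := vh_composite_ex s1 s2; exists s.
apply: functional_extensionality => t; apply: propositional_extensionality.
split=> [[r1 [r2 [r [e1 e2 cr er]]]]|e].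
  by apply: vh_equiv_trans er; apply: vh_composite_equiv cs cr.
by exists s1, s2, s; split=> //; apply: vh_equiv_refl.
Defined.

(** The composite of two classes may be computed on any representatives and
    with any choice of cartesian lift. *)
Lemma vh_comp_class (x y z : X) (s1 : vh_span x y) (s2 : vh_span y z)
    (t : vh_span x z) :
  vh_composite s1 s2 t -> vh_comp (vh_class s1) (vh_class s2) = vh_class t.
Proof.
move=> ct; apply: vh_arrow_ext => u; rewrite vh_in_class.
split=> [[r1 [r2 [r [e1 e2 cr er]]]]|e].
  by apply: vh_equiv_trans er; apply: vh_composite_equiv ct cr.
by exists s1, s2, t; split=> //; apply: vh_equiv_refl.
Qed.

Lemma vh_comp1m (x y : X) (c : vh_arrow x y) :
  vh_comp (vh_class (vh_id_span x)) c = c.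
Proof.
move: c; apply: vh_arrow_ind => s; apply: vh_comp_class.
exists (idm _), (vleg s); rewrite /= compm1 !comp1m; split=> //.
  split; first by apply: cartesian_iso; exists (idm _); rewrite comp1m.
  rewrite !fmap1; apply: arr_idm.
  by have [] := verticalE (vleg_vertical s).
by split=> //; apply: vleg_vertical.
Qed.

Lemma vh_compm1 (x y : X) (c : vh_arrow x y) :
  vh_comp c (vh_class (vh_id_span y)) = c.
Proof.
move: c; apply: vh_arrow_ind => s; apply: vh_comp_class.
exists (hleg s), (idm _); rewrite /= compm1 !comp1m; split=> //.
  by split=> //; apply: hleg_cartesian.
by split=> //; apply: vertical_id.
Qed.

Lemma vh_compA (x y z t : X) (c : vh_arrow x y) (d : vh_arrow y z)
    (e : vh_arrow z t) :
  vh_comp (vh_comp c d) e = vh_comp c (vh_comp d e).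
Proof.
move: c; apply: vh_arrow_ind => s1; move: d; apply: vh_arrow_ind => s2.
move: e; apply: vh_arrow_ind => s3.
have [s12 c12] := vh_composite_ex s1 s2.
have [s23 c23] := vh_composite_ex s2 s3.
have [u cu] := vh_composite_ex s12 s3.
rewrite (vh_comp_class c12) (vh_comp_class c23) (vh_comp_class cu).
apply: esym; apply: vh_comp_class.
move: c12 c23 cu => [k [w [[ck ek] [vw ew] sv sh]]].
move=> [k3 [w3 [[ck3 ek3] [vw3 ew3] sv3 sh3]]].
move=> [k2 [w2 [[ck2 ek2] [vw2 ew2] sv2 sh2]]].
have [_ eu] := verticalE vw2.
have [|||k' [ek' k'k3]] := cartesian_lift (z := apex u) (l := k2)
    (xi := fmap p k) (eta := fmap p (hleg s2)) ck3.
- by [].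
- by [].
- by rewrite ek2 sh fmapM.
have k'w3 : k' ;; w3 = w2 ;; k.
  apply: (cartesian_inj (hleg_cartesian s2)).
    by rewrite (over_idl _ vw2) (over_idr _ vw3).
  by rewrite !compA ew3 -sh -compA k'k3 ew2.
exists k', (w2 ;; w); split.
- split; last by rewrite ek' ek.
  by apply: (cartesian_cancel ck3); rewrite k'k3.
- split; first exact: vertical_comp.
  by rewrite sv3 -compA k'w3 !compA ew.
- by rewrite sv2 sv compA.
- by rewrite sh2 sh3 -compA k'k3.
Qed.

Definition fibrewise_dual : category :=
  {| ob := ob X; hom := vh_arrow; idm := fun x => vh_class (vh_id_span x);
     comp := vh_comp;
     comp1m := vh_comp1m; compm1 := vh_compm1; compA := vh_compA |}.

Lemma vh_base_unique (x y : X) (c : vh_arrow x y) :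
  exists! f : hom (p x) (p y), forall s, vh_in c s -> fmap p (hleg s) ≈ f.
Proof.
move: c; apply: vh_arrow_ind => s.
have [_ e] := verticalE (vleg_vertical s).
have [f ef] := arr_cast (fmap p (hleg s)) e (eq_refl (p y)).
exists f; split=> [t [i [vi _ _ <-]]|g Hg]; first by rewrite (over_idl _ vi) ef.
by apply: arr_eq; rewrite ef; apply: Hg; apply: vh_equiv_refl.
Qed.

(** [π*({(v, h)}) = π(h)].  The arrow [π(h)] starts at [p (apex _)], which is
    equal to [p x] because [v] is vertical, but only propositionally so. *)
Definition vh_base (x y : X) (c : vh_arrow x y) : hom (p x) (p y) :=
  proj1_sig (constructive_definite_description _ (vh_base_unique c)).

Lemma vh_base_class (x y : X) (s : vh_span x y) :
  vh_base (vh_class s) ≈ fmap p (hleg s).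
Proof.
rewrite /vh_base; case: constructive_definite_description => f /= Hf.
by apply: esym; apply: Hf; apply: vh_equiv_refl.
Qed.

Lemma vh_base1 (x : X) : vh_base (vh_class (vh_id_span x)) = idm (p x).
Proof. by apply: arr_eq; rewrite vh_base_class fmap1. Qed.

Lemma vh_baseM (x y z : X) (c : vh_arrow x y) (d : vh_arrow y z) :
  vh_base (vh_comp c d) = vh_base c ;; vh_base d.
Proof.
move: c; apply: vh_arrow_ind => s1; move: d; apply: vh_arrow_ind => s2.
have [t ct] := vh_composite_ex s1 s2.
rewrite (vh_comp_class ct); apply: arr_eq; rewrite vh_base_class.
move: ct => [k [w [[ck ek] _ _ ->]]]; rewrite fmapM.
by apply: arr_comp; rewrite vh_base_class.
Qed.

Definition fibrewise_dual_proj : functor fibrewise_dual B :=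
  {| fob := fob p : fibrewise_dual -> B; fmap := vh_base;
     fmap1 := vh_base1; fmapM := vh_baseM |}.

End Fibration.

Arguments fibrewise_dual {X B p} fib.
Arguments fibrewise_dual_proj {X B p} fib.

(** A pseudofunctor [F : B^op -> Cat], with [ps_map F f] in the role of [f^*].
    The components of [ps_unit] are the isomorphisms [X -> (1_a)^* X], those of
    [ps_mult] the isomorphisms [f^* (g^* Z) -> (f ;; g)^* Z]; a strict functor
    is the case where they are all identities.  In the coherence laws, objects
    such as [((f ;; g) ;; h)^* Z] and [(f ;; (g ;; h))^* Z] are only
    propositionally equal, hence the use of [≈]. *)

Record pseudofunctor (B : category) := Pseudofunctor {
  ps_cat :> B -> category;
  ps_map : forall a b : B, hom a b -> functor (ps_cat b) (ps_cat a);
  ps_unit : forall a, nat_iso (functor_id (ps_cat a)) (ps_map (idm a));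
  ps_mult : forall (a b c : B) (f : hom a b) (g : hom b c),
    nat_iso (functor_comp (ps_map g) (ps_map f)) (ps_map (f ;; g));
  ps_unitl : forall (a b : B) (f : hom a b) (y : ps_cat b),
    ps_unit a (ps_map f y) ;; ps_mult (idm a) f y ≈ idm (ps_map f y);
  ps_unitr : forall (a b : B) (f : hom a b) (y : ps_cat b),
    fmap (ps_map f) (ps_unit b y) ;; ps_mult f (idm b) y ≈ idm (ps_map f y);
  ps_assoc : forall (a b c d : B) (f : hom a b) (g : hom b c) (h : hom c d)
      (z : ps_cat d),
    ps_mult f g (ps_map h z) ;; ps_mult (f ;; g) h z
    ≈ fmap (ps_map f) (ps_mult g h z) ;; ps_mult f (g ;; h) z }.

Arguments ps_map {B} _ {a b} _.
Arguments ps_unit {B} _ _.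
Arguments ps_mult {B} _ {a b c} _ _.

Program Definition nat_iso_op (C D : category) (F G : functor C D)
    (n : nat_iso F G) : nat_iso (functor_op F) (functor_op G) :=
  {| ni_map := ni_inv n : forall a : op C, @hom (op D) (F a) (G a);
     ni_inv := ni_map n : forall a : op C, @hom (op D) (G a) (F a) |}.
Next Obligation. exact: ni_mapK. Qed.
Next Obligation. exact: ni_invK. Qed.
Next Obligation.
by rewrite -(compm1 (ni_inv n b ;; fmap F f)) -(ni_mapK n a) compA -(compA (fmap F f))
  ni_natural !compA -(compA (ni_inv n b)) ni_invK comp1m.
Qed.

(** [F'(A) = F(A)^op] and [F'(f) = F(f)^op]; the coherence isomorphisms are
    the inverses of those of [F].  They are repackaged because, e.g.,
    [functor_op (functor_comp _ _)] and the composite of the opposite functors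
    have the same data but different proof fields. *)
Section PseudofunctorDual.
Variables (B : category) (F : pseudofunctor B).

Definition ps_dual_cat (a : B) : category := op (F a).
Definition ps_dual_map (a b : B) (f : hom a b) : functor (ps_dual_cat b) (ps_dual_cat a) :=
  functor_op (ps_map F f).

Program Definition ps_dual_unit (a : B) :
    nat_iso (functor_id (ps_dual_cat a)) (ps_dual_map (idm a)) :=
  {| ni_map := ni_map (nat_iso_op (ps_unit F a));
     ni_inv := ni_inv (nat_iso_op (ps_unit F a)) |}.
Next Obligation. exact: (ni_mapK (nat_iso_op (ps_unit F a))). Qed.
Next Obligation. exact: (ni_invK (nat_iso_op (ps_unit F a))). Qed.
Next Obligation. exact: (ni_natural (nat_iso_op (ps_unit F a))). Qed.

Program Definition ps_dual_mult (a b c : B) (f : hom a b) (g : hom b c) :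
    nat_iso (functor_comp (ps_dual_map g) (ps_dual_map f)) (ps_dual_map (f ;; g)) :=
  {| ni_map := ni_map (nat_iso_op (ps_mult F f g));
     ni_inv := ni_inv (nat_iso_op (ps_mult F f g)) |}.
Next Obligation. exact: (ni_mapK (nat_iso_op (ps_mult F f g))). Qed.
Next Obligation. exact: (ni_invK (nat_iso_op (ps_mult F f g))). Qed.
Next Obligation. exact: (ni_natural (nat_iso_op (ps_mult F f g))). Qed.

Lemma ps_dual_unitl (a b : B) (f : hom a b) (y : ps_dual_cat b) :
  ps_dual_unit a (ps_dual_map f y) ;; ps_dual_mult (idm a) f y ≈ idm (ps_dual_map f y).
Proof.
apply: arr_op; apply: (arr_inv (ps_unitl f y)); last by rewrite comp1m.
exact: (inv_comp (ni_invK (ps_unit F a) _) (ni_invK (ps_mult F (idm a) f) y)).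
Qed.

Lemma ps_dual_unitr (a b : B) (f : hom a b) (y : ps_dual_cat b) :
  fmap (ps_dual_map f) (ps_dual_unit b y) ;; ps_dual_mult f (idm b) y
  ≈ idm (ps_dual_map f y).
Proof.
apply: arr_op; apply: (arr_inv (ps_unitr f y)); last by rewrite comp1m.
exact: (inv_comp (fmap_inv (ps_map F f) (ni_invK (ps_unit F b) y))
  (ni_invK (ps_mult F f (idm b)) y)).
Qed.

Lemma ps_dual_assoc (a b c d : B) (f : hom a b) (g : hom b c) (h : hom c d)
    (z : ps_dual_cat d) :
  ps_dual_mult f g (ps_dual_map h z) ;; ps_dual_mult (f ;; g) h z
  ≈ fmap (ps_dual_map f) (ps_dual_mult g h z) ;; ps_dual_mult f (g ;; h) z.
Proof.
apply: arr_op; apply: (arr_inv (ps_assoc f g h z)).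
  exact: (inv_comp (ni_invK (ps_mult F f g) (ps_map F h z))
    (ni_invK (ps_mult F (f ;; g) h) z)).
exact: (inv_comp (ni_mapK (ps_mult F f (g ;; h)) z)
  (fmap_inv (ps_map F f) (ni_mapK (ps_mult F g h) z))).
Qed.

Definition pseudofunctor_dual : pseudofunctor B :=
  {| ps_cat := ps_dual_cat; ps_map := ps_dual_map; ps_unit := ps_dual_unit;
     ps_mult := ps_dual_mult; ps_unitl := ps_dual_unitl;
     ps_unitr := ps_dual_unitr; ps_assoc := ps_dual_assoc |}.

End PseudofunctorDual.

Section Grothendieck.
Variables (B : category) (F : pseudofunctor B).

Record groth_ob := GrothOb { gbase : B; gfib : F gbase }.

Record groth_hom (x y : groth_ob) := GrothHom {
  gbase_hom : hom (gbase x) (gbase y);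
  gfib_hom : hom (gfib x) (ps_map F gbase_hom (gfib y)) }.

Lemma groth_hom_eq (x y : groth_ob) (m n : groth_hom x y) :
  gbase_hom m = gbase_hom n -> gfib_hom m ≈ gfib_hom n -> m = n.
Proof.
by case: m n => [f u] [g v] /= e; subst g => /arr_eq ->.
Qed.

Lemma groth_hom_inj (x y : groth_ob) (f : hom (gbase x) (gbase y))
    (u v : hom (gfib x) (ps_map F f (gfib y))) :
  GrothHom u = GrothHom v -> u = v.
Proof.
move=> e; apply: arr_eq.
exact (f_equal (fun m : groth_hom x y => Arrow (gfib_hom m)) e).
Qed.

Definition groth_id (x : groth_ob) : groth_hom x x :=
  GrothHom (ps_unit F (gbase x) (gfib x)).

Definition groth_comp (x y z : groth_ob) (m : groth_hom x y)
    (n : groth_hom y z) : groth_hom x z :=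
  GrothHom (gfib_hom m ;; fmap (ps_map F (gbase_hom m)) (gfib_hom n)
    ;; ps_mult F (gbase_hom m) (gbase_hom n) (gfib z)).

Lemma groth_comp1m (x y : groth_ob) (m : groth_hom x y) :
  groth_comp (groth_id x) m = m.
Proof.
apply: groth_hom_eq => /=; first exact: comp1m.
rewrite -(ni_natural (ps_unit F (gbase x)) (gfib_hom m)) /= compA.
exact: arr_idr (ps_unitl (gbase_hom m) (gfib y)).
Qed.

Lemma groth_compm1 (x y : groth_ob) (m : groth_hom x y) :
  groth_comp m (groth_id y) = m.
Proof.
apply: groth_hom_eq => /=; first exact: compm1.
rewrite compA; exact: arr_idr (ps_unitr (gbase_hom m) (gfib y)).
Qed.

Lemma groth_compA (x y z t : groth_ob) (m : groth_hom x y)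
    (n : groth_hom y z) (o : groth_hom z t) :
  groth_comp (groth_comp m n) o = groth_comp m (groth_comp n o).
Proof.
apply: groth_hom_eq => /=; first exact: compA.
case: m n o => [f u] [g v] [h w] /=.
move: (ps_assoc f g h (gfib t)).
move: (ps_mult F (f ;; g) h (gfib t)) (ps_mult F f (g ;; h) (gfib t)) => /=.
move: (ps_map F (f ;; g ;; h) _) (ps_map F (f ;; (g ;; h)) _) => d d' k l kl.
rewrite !fmapM -!compA (compA _ _ (fmap (ps_map F (f ;; g)) w)).
rewrite -(ni_natural (ps_mult F f g) w) /= !compA.
by do 3! apply: arr_comp => //.
Qed.

Definition groth : category :=
  {| ob := groth_ob; hom := groth_hom; idm := groth_id; comp := groth_comp;
     comp1m := groth_comp1m; compm1 := groth_compm1; compA := groth_compA |}.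

Program Definition groth_proj : functor groth B :=
  {| fob := gbase : groth -> B; fmap := fun x y m => gbase_hom m |}.

Lemma groth_fibration : is_fibration groth_proj.
Proof.
move=> a b alpha y /= e; subst b.
pose x : groth := GrothOb (ps_map F alpha (gfib y)).
pose h : hom x y := @GrothHom x y alpha (idm _).
exists x, h; split=> // z xi [beta u] /= e; subst beta.
pose t := u ;; ni_inv (ps_mult F xi alpha) (gfib y).
exists (@GrothHom z x xi t); split.
  split=> //; rewrite /comp /= /groth_comp /=; congr GrothHom.
  by rewrite fmap1 compm1; apply: compK; apply: (ni_invK (ps_mult F xi alpha)).
move=> [xi' s] [/= e]; subst xi'.
rewrite /comp /= /groth_comp /= => /groth_hom_inj e.
rewrite /t -e fmap1 compm1; congr GrothHom.
by apply: compK; apply: (ni_mapK (ps_mult F xi alpha)).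
Qed.

End Grothendieck.

Arguments groth_fibration {B} F _ _ _ _ _.

Definition iso_over (B X Y : category) (p : functor X B) (q : functor Y B) :
    Prop :=
  exists (G : functor X Y) (H : functor Y X),
    [/\ functor_comp G H = functor_id X, functor_comp H G = functor_id Y,
        functor_comp G q = p & functor_comp H p = q].

(* Main.v *)
From Corelib Require Import ssreflect ssrfun ssrbool.
From Stdlib Require Import Description ProofIrrelevance FunctionalExtensionality.
Require Import Defs.

(** In [groth F] every arrow [(f, w)] factors as the vertical arrow given by
    [w] followed by the cartesian arrow [(f, 1)].  An arrow [(f, u)] of
    [groth (pseudofunctor_dual F)] from [x] to [y] has [u : f^* y -> x] in the
    fibre of [F]; it is sent to the class of the vh span whose vertical leg is
    given by [u] and whose cartesian leg is [(f, 1) : f^* y -> y].  Cartesian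
    lifts are unique up to a unique vertical isomorphism, so each class of vh
    spans has exactly one representative of this form. *)

Set Implicit Arguments.
Unset Strict Implicit.
Unset Printing Implicit Defensive.
Local Open Scope cat_scope.

Lemma functor_ext (C D : category) (F G : functor C D) :
  (forall a, F a = G a) ->
  (forall a b (f : hom a b), fmap F f ≈ fmap G f) -> F = G.
Proof.
case: F G => [Fo Fm F1 FM] [Go Gm G1 GM] /= eo em.
have e : Fo = Go by apply: functional_extensionality.
subst Go; have e : Fm = Gm.
  do 3! apply: functional_extensionality_dep => ?.
  exact: arr_eq (em _ _ _).
by subst Gm; congr Functor; apply: proof_irrelevance.
Qed.

(** * Inverting a functor that is bijective on objects and on hom-sets *)

Section BijectiveFunctor.
Variables (X Y : category) (G : functor X Y) (k : Y -> X).
Hypotheses (fobK : cancel (fob G) k) (kK : cancel k (fob G)).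
Hypothesis fmap_bij : forall (x x' : X) (c : hom (G x) (G x')),
  exists! m : hom x x', fmap G m = c.

Lemma fmap_inj (x x' : X) (m n : hom x x') : fmap G m ≈ fmap G n -> m = n.
Proof.
move=> /arr_eq e; have [l [_ ul]] := fmap_bij (fmap G n).
by rewrite -(ul m e) -(ul n).
Qed.

(** Since [G (k y)] is only propositionally [y], the arrow [c] is first cast along [kK] before
    [fmap_bij] applies; uniqueness is what allows definite description. *)
Lemma inv_hom_unique (y y' : Y) (c : hom y y') :
  exists! m : hom (k y) (k y'), fmap G m ≈ c.
Proof.
have [d ed] := arr_cast c (esym (kK y)) (esym (kK y')).
have [m [em _]] := fmap_bij d.
exists m; split; first by rewrite em.
by move=> n en; apply: fmap_inj; rewrite em ed en.
Qed.

Definition inv_hom (y y' : Y) (c : hom y y') : hom (k y) (k y') :=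
  proj1_sig (constructive_definite_description _ (inv_hom_unique c)).

Lemma inv_homE (y y' : Y) (c : hom y y') : fmap G (inv_hom c) ≈ c.
Proof.
by rewrite /inv_hom; case: constructive_definite_description.
Qed.

Lemma inv_hom1 (y : Y) : inv_hom (idm y) = idm (k y).
Proof. by apply: fmap_inj; rewrite inv_homE fmap1 kK. Qed.

Lemma inv_homM (a b c : Y) (f : hom a b) (g : hom b c) :
  inv_hom (f ;; g) = inv_hom f ;; inv_hom g.
Proof.
apply: fmap_inj; rewrite inv_homE fmapM.
by apply: arr_comp; rewrite inv_homE.
Qed.

Definition inv_functor : functor Y X :=
  {| fob := k; fmap := inv_hom; fmap1 := inv_hom1; fmapM := inv_homM |}.

Lemma bijective_iso_over (B : category) (p : functor X B) (q : functor Y B) :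
  functor_comp G q = p -> iso_over p q.
Proof.
(* With [p] replaced by [G] followed by [q], the inverse lies over [B] because [G] undoes it. *)
move=> <-; exists G, inv_functor; split=> //; apply: functor_ext => //=.
- move=> x x' m; move: (inv_homE (fmap G m)).
  (* Generalizing the arrow lets its endpoints be rewritten. *)
  move: (inv_hom (fmap G m)); rewrite !fobK => n e.
  by rewrite (fmap_inj e).
- by move=> y y' c; apply: inv_homE.
- by move=> y; rewrite kK.
- by move=> y y' c; apply: arr_fmap; apply: inv_homE.
Qed.

End BijectiveFunctor.

(** * Vertical and cartesian arrows in the Grothendieck construction *)

Section GrothendieckArrows.
Variables (B : category) (F : pseudofunctor B).

Definition gob (a : B) (x : F a) : groth F := GrothOb x.

(** An arrow over [idm a] must land in [(1_a)^* y], hence the unit. *)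
Definition vert (a : B) (x y : F a) (u : hom x y) : hom (gob x) (gob y) :=
  @GrothHom B F (gob x) (gob y) (idm a) (u ;; ps_unit F a y).

Definition arr_over (a b : B) (f : hom a b) (x : F a) (y : F b)
    (u : hom x (ps_map F f y)) : hom (gob x) (gob y) :=
  @GrothHom B F (gob x) (gob y) f u.

Definition cart (a b : B) (f : hom a b) (y : F b) :
    hom (gob (ps_map F f y)) (gob y) := arr_over (idm _).

(** Naturality moves the unit past [m], where the left unit law cancels it against [ps_mult]. *)
Lemma vert_arr_over (a b : B) (f : hom a b) (x x' : F a) (y : F b)
    (u : hom x x') (m : hom x' (ps_map F f y)) :
  vert u ;; arr_over m = arr_over (u ;; m).
Proof.
apply: groth_hom_eq => /=; first exact: comp1m.
rewrite (compA u) -(ni_natural (ps_unit F a) m) /= -!compA (compA (u ;; m)).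
exact: arr_idr (ps_unitl f y).
Qed.

Lemma vert1 (a : B) (x : F a) : vert (idm x) = idm (gob x).
Proof. by rewrite /vert comp1m. Qed.

Lemma vertM (a : B) (x y z : F a) (u : hom x y) (v : hom y z) :
  vert u ;; vert v = vert (u ;; v).
Proof. by rewrite [vert v]/vert vert_arr_over -compA. Qed.

Lemma vert_inj (a : B) (x y : F a) (u v : hom x y) : vert u = vert v -> u = v.
Proof.
move=> /groth_hom_inj e.
rewrite -(compm1 u) -(compm1 v) -(ni_mapK (ps_unit F a) y).
by rewrite -!compA e.
Qed.

Lemma vert_iso (a : B) (x y : F a) (u : hom x y) (v : hom y x) :
  u ;; v = idm x -> v ;; u = idm y -> is_iso (vert u).
Proof. by move=> uv vu; exists (vert v); rewrite !vertM uv vu !vert1. Qed.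

Lemma vert_cart (a b : B) (f : hom a b) (x : F a) (y : F b)
    (u : hom x (ps_map F f y)) :
  vert u ;; cart f y = arr_over u.
Proof. by rewrite vert_arr_over compm1. Qed.

Lemma cart_vert (a b : B) (f : hom a b) (y z : F b) (v : hom y z) :
  cart f y ;; vert v = vert (fmap (ps_map F f) v) ;; cart f z.
Proof.
rewrite vert_cart; apply: groth_hom_eq => /=; first exact: compm1.
rewrite comp1m fmapM compA.
exact: arr_idr (ps_unitr f z).
Qed.

Lemma arr_over_cart (a b c : B) (f : hom a b) (g : hom b c) (x : F a) (z : F c)
    (m : hom x (ps_map F f (ps_map F g z))) :
  arr_over m ;; cart g z = arr_over (m ;; ps_mult F f g z).
Proof. by rewrite /comp /= /groth_comp /= fmap1 compm1. Qed.

Lemma cart_id (a : B) (x : F a) :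
  vert (ps_unit F a x) ;; cart (idm a) x = idm (gob x).
Proof. exact: vert_cart. Qed.

Lemma vertical_vert (a : B) (x y : F a) (u : hom x y) :
  vertical (groth_proj F) (vert u).
Proof. by exists a. Qed.

Lemma verticalP (a : B) (x y : F a) (m : hom (gob x) (gob y)) :
  vertical (groth_proj F) m -> exists u : hom x y, m = vert u.
Proof.
move=> /verticalE [/arr_eq /= e _].
case: m e => /= f u e; subst f.
exists (u ;; ni_inv (ps_unit F a) y).
by rewrite /vert (compK _ (ni_invK (ps_unit F a) y)).
Qed.

(** By [arr_over_cart], composing with [cart f y] acts on fibre components as composing with
    [ps_mult], which is invertible. *)
Lemma cartesian_cart (a b : B) (f : hom a b) (y : F b) :
  cartesian (groth_proj F) (cart f y).
Proof.
move=> [c z] xi [g w] e; have {}e : g = xi ;; f by [].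
subst g.
pose t : hom z (ps_map F xi (ps_map F f y)) := w ;; ni_inv (ps_mult F xi f) y.
exists (arr_over t); split.
  split=> //; apply: (etrans (arr_over_cart (g := f) t)).
  by rewrite /t (compK _ (ni_invK (ps_mult F xi f) y)).
move=> [xi' s] [/= e]; subst xi'.
move=> /(etrans (esym (arr_over_cart (x := z) s))) /groth_hom_inj es.
by rewrite /t -es (compK _ (ni_mapK (ps_mult F xi f) y)).
Qed.

(** * Vh spans with a chosen cartesian leg *)

Definition cart_span (a b : B) (f : hom a b) (x : F a) (y : F b)
    (u : hom (ps_map F f y) x) : vh_span (groth_proj F) (gob x) (gob y) :=
  VHSpan (vertical_vert u) (cartesian_cart (f := f) (y := y)).

Notation F' := (pseudofunctor_dual F).

(** Projecting the horizontal legs to [B] gives [f = g]. The comparison [i] is then a vertical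
    endomorphism that fixes a cartesian arrow, so it is the identity. *)
Lemma cart_span_inj (a b : B) (x : F a) (y : F b) (f g : hom a b)
    (u : hom (ps_map F f y) x) (v : hom (ps_map F g y) x) :
  vh_equiv (cart_span u) (cart_span v) ->
  @GrothHom B F' (@GrothOb B F' a x) (@GrothOb B F' b y) f u =
  @GrothHom B F' (@GrothOb B F' a x) (@GrothOb B F' b y) g v.
Proof.
move=> [i [vi _ iv ih]].
have e : f = g.
  apply: arr_eq; rewrite -[f]/(fmap (groth_proj F) (cart f y)).
  by rewrite -(over_idl (cart f y) vi) ih.
subst g; have i1 : i = idm _.
  apply: (cartesian_inj (cartesian_cart (f := f) (y := y))).
    by apply: vertical_eq => //; apply: vertical_id.
  by rewrite comp1m.
by move: iv; rewrite i1 comp1m => /vert_inj ->.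
Qed.

Lemma cart_span_surj (a b : B) (x : F a) (y : F b)
    (s : vh_span (groth_proj F) (gob x) (gob y)) :
  exists (f : hom a b) (u : hom (ps_map F f y) x), vh_equiv s (cart_span u).
Proof.
case: s => [[a' z] v h vv ch].
have [_ /= e] := verticalE vv; subst a'.
pose f : hom a b := gbase_hom h.
have [|i [vi ii ih]] := cartesian_vertical_iso ch (cartesian_cart (f := f) (y := y)).
  by [].
(* The vertical leg, transported along [i] to the chosen lift, comes from an arrow [u] of the
   fibre. *)
have [u eu] := verticalP (vertical_comp vi vv).
by exists f, u, i.
Qed.

Lemma cart_span_id (a : B) (x : F a) :
  vh_equiv (cart_span (ni_inv (ps_unit F a) x)) (vh_id_span (groth_proj F) (gob x)).
Proof.
exists (vert (ps_unit F a x)); split.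
- exact: vertical_vert.
- exact: vert_iso (ni_mapK (ps_unit F a) x) (ni_invK (ps_unit F a) x).
- by rewrite [vleg _]/= vertM (ni_mapK (ps_unit F a)) vert1.
- exact: cart_id.
Qed.

Lemma cart_span_comp (a b c : B) (x : F a) (y : F b) (z : F c)
    (f : hom a b) (g : hom b c)
    (u : hom (ps_map F f y) x) (v : hom (ps_map F g z) y) :
  vh_composite (cart_span u) (cart_span v)
    (cart_span (ni_inv (ps_mult F f g) z ;; (fmap (ps_map F f) v ;; u))).
Proof.
(* The composite has apex [(f ;; g)^* z], while the chosen lift [cart f (g^* z)] starts at
   [f^* (g^* z)]. The isomorphism [m] leads from the former to the latter, so preceding the lift by
   [m] keeps it cartesian. *)
pose m := vert (ni_inv (ps_mult F f g) z).
exists (m ;; cart f (ps_map F g z)), (m ;; vert (fmap (ps_map F f) v)); split.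
- split; last exact: over_idl (vertical_vert _).
  apply: cartesian_comp (cartesian_cart (y := _)); apply: cartesian_iso.
  exact: vert_iso (ni_invK (ps_mult F f g) z) (ni_mapK (ps_mult F f g) z).
- split; first exact: vertical_comp (vertical_vert _) (vertical_vert _).
  by rewrite [hleg _]/= [vleg _]/= compA -cart_vert compA.
- by rewrite [vleg _]/= [vleg _]/= /m !vertM compA.
(* The two chosen lifts compose to [ps_mult] over [f ;; g], which [m] cancels. *)
- rewrite [hleg _]/= [hleg _]/= compA arr_over_cart comp1m vert_arr_over.
  by rewrite (ni_invK (ps_mult F f g)).
Qed.

(** * The comparison functor and its bijectivity *)

Definition span_ob (x : groth F') : fibrewise_dual (groth_fibration F) :=
  @GrothOb B F (gbase x) (gfib x).

Definition unspan_ob (x : fibrewise_dual (groth_fibration F)) : groth F' :=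
  @GrothOb B F' (gbase x) (gfib x).

Definition span_hom (x y : groth F') (m : hom x y) : hom (span_ob x) (span_ob y) :=
  vh_class (@cart_span _ _ (gbase_hom m) (gfib x) (gfib y) (gfib_hom m)).

Lemma span_hom1 (x : groth F') : span_hom (idm x) = idm (span_ob x).
Proof. by apply/vh_class_eq; apply: cart_span_id. Qed.

(** Unfolding the opposite fibres, composition in [groth F'] is by conversion the fibre arrow of
    [cart_span_comp]. *)
Lemma span_homM (x y z : groth F') (m : hom x y) (n : hom y z) :
  span_hom (m ;; n) = span_hom m ;; span_hom n.
Proof. by apply: esym; apply: vh_comp_class; apply: cart_span_comp. Qed.

Definition span_functor : functor (groth F') (fibrewise_dual (groth_fibration F)) :=
  {| fob := span_ob; fmap := span_hom; fmap1 := span_hom1; fmapM := span_homM |}.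

Lemma span_hom_bij (x y : groth F') (c : hom (span_ob x) (span_ob y)) :
  exists! m : hom x y, span_hom m = c.
Proof.
case: x y c => [a x] [b y] c; elim/vh_arrow_ind: c => s.
have [f [u e]] := cart_span_surj s.
exists (@GrothHom B F' (@GrothOb B F' a x) (@GrothOb B F' b y) f u); split.
  by apply/vh_class_eq; apply: vh_equiv_sym.
move=> [g v] /vh_class_eq e'; apply: cart_span_inj.
by apply: vh_equiv_sym; apply: vh_equiv_trans e' e.
Qed.

End GrothendieckArrows.

Theorem mainTheorem2 (B : category) (F : pseudofunctor B) :
  iso_over (groth_proj (pseudofunctor_dual F))
           (fibrewise_dual_proj (groth_fibration F)).
Proof.
apply: (bijective_iso_over (G := span_functor F) (k := @unspan_ob B F)).
- by case.
- by case.
- exact: span_hom_bij.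
- apply: functor_ext => // x y m.
  exact: (vh_base_class (@cart_span B F _ _ _ (gfib x) (gfib y) (gfib_hom m))).
Qed.
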